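(* Let $H$ be a real Hilbert space, $C\subseteq H$ a nonempty closed convex subset, and $f:H\times H\to\mathbb{R}\cup\{+\infty\}$ a bifunction with $f(x,y)<+\infty$ for all $x,y\in C$. Let $\mathrm{Sol}(C,f)=\{x\in C: f(x,y)\ge 0\ \forall y\in C\}$. Assume: (A1) $f(x,x)=0$ for all $x\in C$; (A4) for every $x\in C$, $f(x,\cdot)$ is convex, lower semicontinuous and subdifferentiable on $C$; (A5) there are constants $c_1,c_2>0$ such that $f(x,y)+f(y,z)\ge f(x,z)-c_1\|x-y\|^2-c_2\|y-z\|^2$ for all $x,y,z\in C$; (A6) either $\mathrm{int}\,C\ne\emptyset$, or for every $x\in C$ the function $f(x,\cdot)$ is continuous at some point of $C$; (A8) $\mathrm{Sol}(C,f)\neq\emptyset$; (A9) $f$ is strongly pseudomonotone on $C$ with some modulus $\gamma>0$: for all $x,y\in C$, $f(x,y)\ge 0$ implies $f(y,x)\le-\gamma\|x-y\|^2$. Let $\varphi=\frac{\sqrt5+1}{2}$ and let $\{\lambda_k\}_{k\ge 0}$ be a sequence of positive numbers with $\lim_{k\to\infty}\lambda_k=0$ and $\sum_{k=0}^\infty\lambda_k=+\infty$. Let $x^0,y^1\in C$ be arbitrary and, for $k\ge 1$, define $$x^k=\frac{(\varphi-1)y^k+x^{k-1}}{\varphi},\qquad y^{k+1}=\operatorname{argmin}\left\{\lambda_k f(y^k,y)+\tfrac12\|y-x^k\|^2: y\in C\right\}.$$ Then the sequence $\{x^k\}$ converges strongly (in norm) to the unique element of $\mathrm{Sol}(C,f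)$.
   Context: The equilibrium problem asks for $\bar x\in C$ with $f(\bar x,y)\ge 0$ for all $y\in C$; $\mathrm{Sol}(C,f)$ is its solution set. A convex function $g:H\to(-\infty,+\infty]$ is subdifferentiable on $C$ if $\partial g(x)=\{w\in H: g(y)-g(x)\ge\langle w,y-x\rangle\ \forall y\in H\}$ is nonempty for every $x\in C$. The algorithm also carries the stopping criterion ''stop if $y^{k+1}=y^k=x^k$''; the convergence assertion concerns the infinite sequence produced by the recursion. *)

(* Defs.v *)
From HB Require Import structures.
From mathcomp Require Import all_boot all_order all_algebra.
From mathcomp Require Import all_classical all_reals all_analysis.

Set Implicit Arguments.
Unset Strict Implicit.
Unset Printing Implicit Defensive.

Import Order.TTheory GRing.Theory Num.Theory.
Import numFieldNormedType.Exports.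

Local Open Scope classical_set_scope.
Local Open Scope ring_scope.

(* A real Hilbert space is a complete normed module [H] over [R : realType]
   with a positive definite symmetric bilinear form [ip : {dot H for idfun}]
   that induces the norm of [H]. *)
Definition induces_norm (R : realType) (H : completeNormedModType R)
    (ip : {dot H for idfun}) : Prop :=
  forall u : H, `|u| = Num.sqrt (ip u u).

(* [convex_function] of the library is for finite-valued functions only. With
   values in ]-oo, +oo] and 0 < t < 1, the right-hand side is never of the
   form +oo - oo or 0 * +oo. *)
Definition econvex_function (R : realType) (E : lmodType R)
    (g : E -> \bar R) : Prop :=
  forall (u v : E) (t : R), 0 < t -> t < 1 ->
    (g (t *: u + (1 - t) *: v)%R <= t%:E * g u + (1 - t)%:E * g v)%E.

(* The subtraction convention +oo - +oo = -oo makes this set empty where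
   g u = +oo. *)
Definition subdifferential (R : realType) (H : completeNormedModType R)
    (ip : {dot H for idfun}) (g : H -> \bar R) (u : H) : set H :=
  [set w | forall v : H, ((ip w (v - u))%:E <= g v - g u)%E].

Definition subdifferentiable_on (R : realType) (H : completeNormedModType R)
    (ip : {dot H for idfun}) (C : set H) (g : H -> \bar R) : Prop :=
  forall u : H, C u -> subdifferential ip g u !=set0.

Definition Sol (R : realType) (H : Type) (C : set H) (f : H -> H -> \bar R)
    : set H :=
  [set u | C u /\ forall v : H, C v -> (0 <= f u v)%E].

Definition strongly_pseudomonotone_on (R : realType)
    (H : completeNormedModType R) (C : set H) (f : H -> H -> \bar R)
    (gamma : R) : Prop :=
  forall u v : H, C u -> C v -> (0 <= f u v)%E ->
    (f v u <= (- (gamma * `|u - v| ^+ 2))%:E)%E.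

Definition argmin (R : realType) (H : Type) (C : set H) (g : H -> \bar R)
    : set H :=
  [set u | C u /\ forall v : H, C v -> (g u <= g v)%E].

Definition golden_ratio (R : realType) : R := (Num.sqrt 5 + 1) / 2.

(* Main.v *)
Require Import Defs.
From HB Require Import structures.
From mathcomp Require Import all_boot all_order all_algebra.
From mathcomp Require Import all_classical all_reals all_analysis.
From mathcomp Require Import ring lra.

Set Implicit Arguments.
Unset Strict Implicit.
Unset Printing Implicit Defensive.

Import Order.TTheory GRing.Theory Num.Theory.
Import numFieldNormedType.Exports.

Local Open Scope classical_set_scope.
Local Open Scope ring_scope.

(** Write [q = 1 - 1/phi], so that [x_k = q y_k + (1 - q) x_(k-1)], and let
    [s] be a solution. One step of the method contracts towards [s] thanks to
    strong pseudomonotonicity, up to an error that the vanishing step sizes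
    make negligible.

    Let [a = y_k], [b = y_(k+1)] and [l = lambda_k]. Strong pseudomonotonicity
    gives [f b s <= - gamma |b - s|^2], but the proximal step defining [b]
    involves [f a s - f a b], and the Lipschitz-type condition compares it with
    [f b s] only at the price of [c2 |b - s|^2], which may exceed
    [gamma |b - s|^2]. The way out is to test the minimality of [b] not at [s]
    but at [z = t s + (1 - t) b]: convexity bounds [f b z] by
    [- t gamma |b - s|^2], of first order in [t], while the Lipschitz-type loss
    is [c2 t^2 |b - s|^2]. For a small fixed [t] the gain wins
    ([contraction_toward_solution]):
      [|b - x_k|^2 + (1 + l gamma) |b - s|^2
         <= |x_k - s|^2 + 2 l K |b - a|^2],
    where [K] depends on [c1], [c2] and [gamma] only. Only the
    minimality condition of step [k] is used, hence the error carries the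
    factor [lambda_k] rather than a ratio of consecutive step sizes.

    Since [x_(k+1)] is a convex combination of [b] and [x_k], and since
    [|b - a|^2] is at most twice the sum of [|y_(k+1) - x_k|^2] and
    [|y_k - x_(k-1)|^2], the energy
      [E_k = |x_(k+1) - s|^2 + q/2 |y_(k+1) - x_k|^2]
    satisfies [E_(k+1) <= (1 - (q gamma / 2) lambda_(k+1)) E_k] as soon as
    [lambda_(k+1)] is small ([energy_contraction]). The divergence of the
    series of the [lambda_k] then forces [E_k] to tend to [0]
    ([divergent_contraction_cvg0]). *)

(** * Convex combinations and squared norms *)

Lemma convex_set_conv (R : realType) (E : lmodType R) (C : set E) :
  convex_set C -> forall (u v : E) (t : R), C u -> C v -> 0 < t -> t < 1 ->
  C (t *: u + (1 - t) *: v).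
Proof.
move=> cC u v t Cu Cv t0 t1.
have t01 : Itv.spec (@Itv.num_sem R) (Itv.Real `[0%Z, 1%Z]) t.
  by rewrite /Itv.spec /= /Itv.num_sem /= num_real in_itv /= !ltW.
have := cC u v (Itv.mk t01); rewrite !inE; exact.
Qed.

Lemma sqr_normD_le (R : realType) (E : normedModType R) (u v : E) :
  `|u + v| ^+ 2 <= 2 * `|u| ^+ 2 + 2 * `|v| ^+ 2.
Proof.
have := ler_normD u v; have := normr_ge0 (u + v).
have := sqr_ge0 (`|u| - `|v|); nra.
Qed.

(** The Hilbert structure enters the convergence proof through this identity
    alone: it makes [|. - x|^2] uniformly convex with the exact modulus. *)
Lemma sqr_norm_conv (R : realType) (H : completeNormedModType R)
    (ip : {dot H for idfun}) (H_hilbert : induces_norm ip) (u v : H) (t : R) :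
  `|t *: u + (1 - t) *: v| ^+ 2
    = t * `|u| ^+ 2 + (1 - t) * `|v| ^+ 2 - t * (1 - t) * `|u - v| ^+ 2.
Proof.
have ip_ge0 w : 0 <= ip w w.
  by have [->|/neq0_dnorm_gt0 /ltW //] := eqVneq w 0; rewrite linear0l.
have sqrE w : `|w| ^+ 2 = ip w w by rewrite H_hilbert sqr_sqrtr.
have ipC w w' : ip w w' = ip w' w.
  by rewrite hermC expr0 mul1r.
rewrite !sqrE !(linearBl, linearBr, linearDl, linearDr) /=.
rewrite !linearZl_LR !linearZr_LR /= (ipC v u) /GRing.scale /=; ring.
Qed.

Lemma conv_subr (R : realType) (E : lmodType R) (t : R) (u v w : E) :
  t *: u + (1 - t) *: v - w = t *: (u - w) + (1 - t) *: (v - w).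
Proof.
by rewrite !scalerBr addrACA -opprD -scalerDl addrCA subrr addr0 scale1r.
Qed.

Lemma conv_subl (R : realType) (E : lmodType R) (t : R) (u v : E) :
  t *: u + (1 - t) *: v - v = t *: (u - v).
Proof. by rewrite conv_subr subrr scaler0 addr0. Qed.

Lemma sqr_dist_conv (R : realType) (H : completeNormedModType R)
    (ip : {dot H for idfun}) (H_hilbert : induces_norm ip)
    (u v w : H) (t : R) :
  `|t *: u + (1 - t) *: v - w| ^+ 2
    = t * `|u - w| ^+ 2 + (1 - t) * `|v - w| ^+ 2
      - t * (1 - t) * `|u - v| ^+ 2.
Proof.
rewrite conv_subr (sqr_norm_conv H_hilbert).
by rewrite (_ : u - w - (v - w) = u - v) // opprB addrA subrK.
Qed.

(** * One proximal step *)

(** The form that [econvex_function] takes at points of [C] for a function with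
    real values on [C]. *)
Definition real_convex_on (R : realType) (E : lmodType R) (C : set E)
    (g : E -> R) : Prop :=
  forall u v t, C u -> C v -> 0 < t -> t < 1 ->
    g (t *: u + (1 - t) *: v) <= t * g u + (1 - t) * g v.

(** With [v' = t v + (1 - t) p] in the minimality of [p], the terms of order
    [t] bound the left-hand side with [(1 - t) |v - p|^2] in place of
    [|v - p|^2]; then [t] tends to [0]. *)
Lemma prox_three_point (R : realType) (H : completeNormedModType R)
    (ip : {dot H for idfun}) (H_hilbert : induces_norm ip)
    (C : set H) (C_convex : convex_set C) (g : H -> R) (l : R) (p x v : H) :
  0 < l -> real_convex_on C g -> C p -> C v ->
  (forall w, C w -> l * g p + 2^-1 * `|p - x| ^+ 2
                    <= l * g w + 2^-1 * `|w - x| ^+ 2) ->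
  `|p - x| ^+ 2 + `|v - p| ^+ 2 - `|v - x| ^+ 2 <= 2 * l * (g v - g p).
Proof.
move=> l0 cg Cp Cv pmin.
suff secant t : 0 < t -> t < 1 ->
    `|p - x| ^+ 2 + (1 - t) * `|v - p| ^+ 2 - `|v - x| ^+ 2
      <= 2 * l * (g v - g p).
  apply/ler_addgt0Pr => eps eps0.
  have D0 : 0 <= `|v - p| ^+ 2 by [].
  set D := `|v - p| ^+ 2 in D0 secant *.
  have d0 : 0 < D + eps + 1 by lra.
  have tE : eps / (D + eps + 1) * (D + eps + 1) = eps by rewrite divfK ?gt_eqF.
  have t0 : 0 < eps / (D + eps + 1) by rewrite divr_gt0.
  have t1 : eps / (D + eps + 1) < 1 by rewrite ltr_pdivrMr // mul1r; lra.
  (* The witness [t] satisfies [t |v - p|^2 <= eps]. *)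
  have := secant _ t0 t1; move: (eps / _) tE t0 t1 => t tE t0 t1.
  nra.
move=> t0 t1.
have := pmin _ (convex_set_conv C_convex Cv Cp t0 t1).
rewrite (sqr_dist_conv H_hilbert).
have := ler_wpM2l (ltW l0) (cg _ _ _ Cv Cp t0 t1).
move: (g (t *: v + _)) (g v) (g p) => gz gv gp cgz h.
rewrite -(ler_pM2l t0).
nra.
Qed.

(** The minimality of [b] is used at [t s + (1 - t) b] instead of [s]: the
    negative term [f b s] contributes at order [t] by convexity, and the
    Lipschitz-type condition costs [c2 |b - s|^2] at order [t^2] only. The
    choice [t = gamma / (gamma + 2 c2)] makes [t c2 <= gamma / 2], so half of
    the strong pseudomonotonicity survives whatever the size of [c2]. *)
Lemma contraction_toward_solution (R : realType) (H : completeNormedModType R)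
    (ip : {dot H for idfun}) (H_hilbert : induces_norm ip)
    (C : set H) (C_convex : convex_set C) (f : H -> H -> R)
    (c1 c2 gamma l : R) (a b s x : H) :
  0 < l -> 0 < c2 -> 0 < gamma ->
  C b -> C s ->
  real_convex_on C (f a) -> real_convex_on C (f b) ->
  f b b = 0 -> f b s <= - (gamma * `|b - s| ^+ 2) ->
  (forall w, C w -> f a w - c1 * `|a - b| ^+ 2 - c2 * `|b - w| ^+ 2
                    <= f a b + f b w) ->
  (forall w, C w -> l * f a b + 2^-1 * `|b - x| ^+ 2
                    <= l * f a w + 2^-1 * `|w - x| ^+ 2) ->
  `|b - x| ^+ 2 + `|b - s| ^+ 2 - `|x - s| ^+ 2
    <= - (l * gamma * `|b - s| ^+ 2)
       + 2 * l * (c1 * (gamma + 2 * c2) / gamma) * `|b - a| ^+ 2.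
Proof.
move=> l0 c20 g0 Cb Cs cfa cfb fbb fbs A5 bmin.
have d0 : 0 < gamma + 2 * c2 by lra.
set K := c1 * _ / _.
pose t := gamma / (gamma + 2 * c2).
have tE : t * (gamma + 2 * c2) = gamma by rewrite divfK ?gt_eqF.
have t0 : 0 < t by rewrite divr_gt0.
have t1 : t < 1 by rewrite ltr_pdivrMr // mul1r; lra.
have KE : t * K = c1 by rewrite /t /K; field; rewrite !gt_eqF.
have Cz := convex_set_conv C_convex Cs Cb t0 t1.
have := prox_three_point H_hilbert C_convex l0 cfa Cb Cz bmin.
have := A5 _ Cz; have := cfb _ _ _ Cs Cb t0 t1.
rewrite conv_subl (sqr_dist_conv H_hilbert).
rewrite (distrC b (_ + _)) conv_subl normrZ exprMn gtr0_norm //.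
rewrite fbb mulr0 addr0 (distrC s b) (distrC s x) (distrC a b).
move: (f b _) (f a _) => fbz faz.
move: fbs.
have : 0 <= `|b - s| ^+ 2 by [].
move: (f b s) (f a b) (`|b - s| ^+ 2) (`|b - x| ^+ 2) (`|x - s| ^+ 2)
   (`|b - a| ^+ 2).
move=> fbs fab Y P X Q Y0 h1 h2 h3 h4.
have h1' : t * fbs <= t * - (gamma * Y) by rewrite ler_pM2l.
have tc : t * c2 <= gamma / 2 by nra.
have h5 : t * (t * c2 * Y) <= t * (gamma / 2 * Y).
  by rewrite ler_pM2l // ler_wpM2r.
have h6 : l * (faz - fab) <= l * (t * (- (gamma / 2 * Y) + K * Q)).
  by rewrite ler_pM2l // mulrDr mulrA KE; lra.
rewrite -(ler_pM2l t0); lra.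
Qed.

(** * Decay of the energy *)

(** From rank [N] on, [e] is nonincreasing and telescoping gives
    [d \sum l_(k+1) e_k <= e_N]. If [e] stayed above some [eps > 0], the partial
    sums of [l] would be bounded by a constant plus [e_N / (d eps)]. *)
Lemma divergent_contraction_cvg0 (R : realType) (e l : nat -> R) (d : R)
    (N : nat) :
  0 < d -> (forall k, 0 <= e k) -> (forall k, 0 <= l k) ->
  (\sum_(0 <= k <oo) (l k)%:E = +oo)%E ->
  (forall k, (N <= k)%N -> e k.+1 <= (1 - d * l k.+1) * e k) ->
  e k @[k --> \oo] --> (0 : R).
Proof.
move=> d0 e0 l0 lsum rec.
have e_noninc k n : (N <= k)%N -> e (k + n)%N <= e k.
  move=> Nk; elim: n => [|n IH]; first by rewrite addn0.
  rewrite addnS; apply: le_trans IH.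
  apply: le_trans (rec _ (leq_trans Nk (leq_addr _ _))) _.
  by rewrite mulrBl mul1r gerBl !mulr_ge0 // ltW.
apply/cvgr0Pnorm_lt => eps eps0.
suff [k Nk ek] : exists2 k, (N <= k)%N & e k < eps.
  exists k => // n /= kn; rewrite ger0_norm // -(subnKC kn).
  exact: le_lt_trans (e_noninc _ _ Nk) ek.
apply: contrapT => no_small.
have e_ge k : (N <= k)%N -> eps <= e k.
  by move=> Nk; rewrite leNgt; apply/negP => ?; apply: no_small; exists k.
have partial n :
    d * eps * (\sum_(N.+1 <= k < N.+1 + n) l k) <= e N - e (N + n)%N.
  elim: n => [|n IH]; first by rewrite !addn0 big_geq // mulr0 subrr.
  rewrite !addnS big_nat_recr ?leq_addr //= ?addSn; rewrite addSn in IH.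
  have Nn := leq_addr n N.
  have := rec _ Nn; have := e_ge _ Nn; have := l0 (N + n).+1.
  move: (e (N + n)%N) (e (N + n).+1) (l (N + n).+1) (\sum_(_ <= _ < _) _) IH.
  move=> a b c S IH c0 ea ba.
  have : 0 <= d * c * (a - eps) by rewrite !mulr_ge0 ?subr_ge0 // ltW.
  lra.
pose B := \sum_(0 <= k < N.+1) l k + e N / (d * eps).
have bounded n : (N.+1 <= n)%N -> \sum_(0 <= k < n) l k <= B.
  move=> Nn; rewrite (big_cat_nat (leq0n N.+1) Nn) /= lerD2l.
  rewrite ler_pdivlMr ?mulr_gt0 // mulrC -{1}(subnKC Nn).
  by apply: le_trans (partial _) _; rewrite gerBl.
suff : (\sum_(0 <= k <oo) (l k)%:E <= B%:E)%E by rewrite lsum leye_eq.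
apply: lime_le; first by apply: is_cvg_nneseries => n _ _; rewrite lee_fin.
by exists N.+1 => // n /= Nn; rewrite sumEFin lee_fin; exact: bounded.
Qed.

(** In the application [X], [X'], [Y] are the squared distances from [x_(k+1)],
    [x_(k+2)], [y_(k+2)] to the solution, [P] and [P'] are
    [|y_(k+1) - x_k|^2] and [|y_(k+2) - x_(k+1)|^2], and
    [Q = |y_(k+2) - y_(k+1)|^2]. Averaging leaves the surplus
    [- q (2 - q) P' <= - q P'] in the bound on [X']. Half of it is stored in
    the energy to absorb, at the next step, the part of [Q] that involves the
    previous residual; the other half absorbs the errors of order [l P']. *)
Lemma energy_contraction (R : realFieldType) (q K gamma l X X' Y P P' Q : R) :
  0 < q -> q < 1 -> 0 < K -> 0 < gamma -> 0 < l ->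
  l * (16 * K + 2 * gamma) <= 1 ->
  0 <= X -> 0 <= P -> 0 <= P' ->
  P' + Y - X <= - (l * gamma * Y) + 2 * l * K * Q ->
  Q <= 2 * P' + 2 * P -> X <= 2 * Y + 2 * P' ->
  X' = q * Y + (1 - q) * X - q * (1 - q) * P' ->
  X' + q / 2 * P' <= (1 - q * gamma / 2 * l) * (X + q / 2 * P).
Proof.
move=> q0 q1 K0 g0 l0 lsmall X0 P0 P'0 step QP XY ->.
have lK0 : 0 < l * K by rewrite mulr_gt0.
have lg0 : 0 < l * gamma by rewrite mulr_gt0.
have lKQ : l * K * Q <= l * K * (2 * P' + 2 * P) by rewrite ler_pM2l.
have lgX : l * gamma * X <= l * gamma * (2 * Y + 2 * P') by rewrite ler_pM2l.
have coefP' : (l * K * 4 + l * gamma) * P' <= 2^-1 * P'.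
  by rewrite ler_wpM2r //; lra.
have qlg : q * (l * gamma) <= l * gamma by rewrite ler_piMl // ltW.
have coefP : (l * K * 4) * P <= (1 - q * (l * gamma) / 2) / 2 * P.
  by rewrite ler_wpM2r //; lra.
have : q * (2^-1 * P' + Y)
    <= q * (X - l * gamma / 2 * X + (1 - q * (l * gamma) / 2) / 2 * P).
  by rewrite ler_pM2l //; lra.
have : 0 <= q * ((1 - q) * P') by rewrite !mulr_ge0 ?subr_ge0 // ltW.
lra.
Qed.

(** * Convergence to the unique solution *)

Lemma Sol_unique (R : realType) (H : completeNormedModType R) (C : set H)
    (f : H -> H -> \bar R) (gamma : R) :
  0 < gamma -> strongly_pseudomonotone_on C f gamma ->
  forall s s', Sol C f s -> Sol C f s' -> s = s'.
Proof.
move=> g0 fsp s s' [Cs fs] [Cs' fs'].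
have := le_trans (fs' _ Cs) (fsp _ _ Cs Cs' (fs _ Cs')).
rewrite lee_fin oppr_ge0 pmulr_rle0 // => h.
apply/eqP; rewrite -subr_eq0 -normr_eq0 -sqrf_eq0 eq_le h /=; exact: sqr_ge0.
Qed.

Lemma golden_ratio_gt1 (R : realType) : 1 < golden_ratio R.
Proof.
have : Num.sqrt 1 < Num.sqrt 5 :> R by rewrite ltr_sqrt; lra.
rewrite sqrtr1 /golden_ratio; lra.
Qed.

Theorem theorem4p1 (R : realType) (H : completeNormedModType R)
    (ip : {dot H for idfun}) (H_hilbert : induces_norm ip)
    (C : set H) (C_nonempty : C !=set0) (C_closed : closed C)
    (C_convex : convex_set C)
    (f : H -> H -> \bar R)
    (f_codomain : forall u v : H, f u v <> -oo%E)
    (f_finite : forall u v : H, C u -> C v -> (f u v < +oo)%E)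
    (A1 : forall u : H, C u -> f u u = 0%E)
    (A4 : forall u : H, C u ->
      [/\ econvex_function (f u),
          lower_semicontinuous (f u) &
          subdifferentiable_on ip C (f u)])
    (c1 c2 : R) (c1_gt0 : 0 < c1) (c2_gt0 : 0 < c2)
    (A5 : forall u v w : H, C u -> C v -> C w ->
      (f u v + f v w >=
         f u w - (c1 * `|u - v| ^+ 2)%:E - (c2 * `|v - w| ^+ 2)%:E)%E)
    (A6 : interior C !=set0 \/
      forall u : H, C u -> exists2 v : H, C v & {for v, continuous (f u)})
    (A8 : Sol C f !=set0)
    (gamma : R) (gamma_gt0 : 0 < gamma)
    (A9 : strongly_pseudomonotone_on C f gamma)
    (lambda : nat -> R) (lambda_gt0 : forall k : nat, 0 < lambda k)
    (lambda_lim : lambda k @[k --> \oo] --> (0 : R))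
    (lambda_sum : (\sum_(0 <= k <oo) (lambda k)%:E = +oo)%E)
    (x y : nat -> H) (x0_in_C : C (x 0%N)) (y1_in_C : C (y 1%N))
    (x_rec : forall k : nat, (1 <= k)%N ->
      x k = (golden_ratio R)^-1 *: ((golden_ratio R - 1) *: y k + x k.-1))
    (y_rec : forall k : nat, (1 <= k)%N ->
      argmin C (fun v : H => ((lambda k)%:E * f (y k) v
                              + (2^-1 * `|v - x k| ^+ 2)%:E)%E) (y k.+1)) :
  exists xbar : H, Sol C f = [set xbar] /\ x k @[k --> \oo] --> xbar.
Proof.
have [s Ss] := A8; exists s; split.
  apply/seteqP; split => [s' Ss'|s' ->] //=.
  exact: Sol_unique gamma_gt0 A9 _ _ Ss' Ss.
have [Cs fs_ge0] := Ss.
(* On [C] all values of [f] are finite, so the proof runs on real numbers. *)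
pose F u v := fine (f u v).
have fE u v : C u -> C v -> f u v = (F u v)%:E.
  move=> Cu Cv; rewrite fineK // fin_numE; apply/andP; split.
    exact/eqP/f_codomain.
  by rewrite -ltey f_finite.
have F_convex u : C u -> real_convex_on C (F u).
  move=> Cu v w t Cv Cw t0 t1; have [cfu _ _] := A4 _ Cu.
  have := cfu v w t t0 t1.
  by rewrite !fE // ?lee_fin //; exact: convex_set_conv.
have F_diag u : C u -> F u u = 0 by move=> Cu; rewrite /F A1.
have F_lip u v w : C u -> C v -> C w ->
    F u w - c1 * `|u - v| ^+ 2 - c2 * `|v - w| ^+ 2 <= F u v + F v w.
  by move=> Cu Cv Cw; have := A5 _ _ _ Cu Cv Cw; rewrite !fE // lee_fin.
have F_sol u : C u -> F u s <= - (gamma * `|u - s| ^+ 2).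
  move=> Cu; have := A9 _ _ Cs Cu (fs_ge0 _ Cu).
  by rewrite distrC fE // lee_fin.
have Cy k : C (y k.+1).
  by case: k => [//|k]; have [] := y_rec k.+1 isT.
have y_min k w : C w ->
    lambda k.+1 * F (y k.+1) (y k.+2) + 2^-1 * `|y k.+2 - x k.+1| ^+ 2
      <= lambda k.+1 * F (y k.+1) w + 2^-1 * `|w - x k.+1| ^+ 2.
  move=> Cw; have [_ /(_ _ Cw)] := y_rec k.+1 isT.
  by rewrite !fE // -!EFinM -!EFinD lee_fin.
have phi1 := golden_ratio_gt1 R; set phi := golden_ratio R in phi1 x_rec.
pose q := 1 - phi^-1.
have phi0 : 0 < phi by lra.
have q0 : 0 < q by rewrite subr_gt0 invf_lt1.
have q1 : q < 1 by rewrite gtrBl invr_gt0.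
have x_conv k : x k.+1 = q *: y k.+1 + (1 - q) *: x k.
  rewrite x_rec // scalerDr scalerA /q mulrBr mulVf ?gt_eqF // mulr1.
  by rewrite opprB addrCA subrr addr0.
pose K := c1 * (gamma + 2 * c2) / gamma.
have K0 : 0 < K by rewrite divr_gt0 // mulr_gt0 // addr_gt0 // mulr_gt0.
have [N _ lsmall] : \forall k \near \oo, lambda k * (16 * K + 2 * gamma) <= 1.
  have d0 : 0 < 16 * K + 2 * gamma by lra.
  have : 0 < (16 * K + 2 * gamma)^-1 by rewrite invr_gt0.
  move/(cvgr0_norm_lt _ lambda_lim); apply: filterS => k.
  rewrite gtr0_norm // => /ltW; rewrite -ler_pdivlMr //; by rewrite mul1r.
pose X k := `|x k - s| ^+ 2; pose P k := `|y k.+1 - x k| ^+ 2.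
pose E k := X k.+1 + q / 2 * P k.
have E_rec k : (N <= k)%N ->
    E k.+1 <= (1 - q * gamma / 2 * lambda k.+1) * E k.
  move=> Nk.
  have step := contraction_toward_solution H_hilbert C_convex
    (lambda_gt0 k.+1) c2_gt0 gamma_gt0 (Cy k.+1) Cs (F_convex _ (Cy k))
    (F_convex _ (Cy k.+1)) (F_diag _ (Cy k.+1)) (F_sol _ (Cy k.+1))
    (fun w Cw => F_lip _ _ _ (Cy k) (Cy k.+1) Cw) (y_min k).
  apply: energy_contraction step _ _ _ => //.
  - exact/lsmall/leqW.
  - exact: sqr_ge0.
  (* [x_(k+1) - y_(k+1) = (1 - q) (x_k - y_(k+1))], hence
     [|x_(k+1) - y_(k+1)|^2 <= P k]. *)
  - rewrite (_ : y k.+2 - y k.+1 = y k.+2 - x k.+1 + (x k.+1 - y k.+1));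
      last by rewrite addrA subrK.
    apply: le_trans (sqr_normD_le _ _) _; rewrite lerD2l ler_pM2l //.
    rewrite x_conv conv_subr subrr scaler0 add0r normrZ exprMn (distrC (x k)).
    rewrite ler_piMl ?sqr_ge0 // expr_le1 // ger0_norm; lra.
  - rewrite /X (_ : x k.+1 - s = (y k.+2 - s) + (x k.+1 - y k.+2));
      last by rewrite [RHS]addrC addrA subrK.
    by apply: le_trans (sqr_normD_le _ _) _; rewrite (distrC (x k.+1)).
  - by rewrite /X x_conv (sqr_dist_conv H_hilbert).
have E0 : E k @[k --> \oo] --> (0 : R).
  apply: (@divergent_contraction_cvg0 _ _ lambda) E_rec.
  - by rewrite !mulr_gt0.
  - move=> k; rewrite addr_ge0 ?sqr_ge0 // mulr_ge0 ?sqr_ge0 //.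
    by rewrite divr_ge0 // ltW.
  - by move=> k; exact: ltW.
  - exact: lambda_sum.
apply/cvgrPdist_lt => eps eps0.
have [M _ EM] := cvgr0_norm_lt _ E0 _ (exprn_gt0 2 eps0).
exists M.+1 => //= -[//|k] Mk.
have := le_lt_trans (ler_norm _) (EM k Mk); rewrite distrC => Ek.
rewrite -(ltr_pXn2r (n := 2)) ?nnegrE // ?ltW //.
by apply: le_lt_trans Ek; rewrite lerDl mulr_ge0 ?sqr_ge0 // divr_ge0 // ltW.
Qed.
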